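(* Let $N=2^L$ with $L$ a positive integer, let $D_1,\ldots,D_N,R$ be positive integers, let $\mathcal{A}\in\mathbb{R}^{D_1\times\cdots\times D_N}$ and $\epsilon>0$. Suppose that for all canonical partitions $(\mathcal{K},\mathcal{K}^c)\in\mathcal{C}_N$ it holds that $\mathrm{QE}(\mathcal{A};\mathcal{K})\le\frac{\epsilon^2}{(2N-3)\|\mathcal{A}\|^2}\ln(R)$. Then there exists an assignment of the tensors of the locally connected tensor network of width $R$ such that the tensor $\mathcal{W}_{\mathrm{TN}}\in\mathbb{R}^{D_1\times\cdots\times D_N}$ it generates satisfies $\|\mathcal{W}_{\mathrm{TN}}-\mathcal{A}\|\le\epsilon$.
   Context: $[N]=\{1,\ldots,N\}$; norms are Frobenius (Euclidean) norms. For a tensor $\mathcal{A}\in\mathbb{R}^{D_1\times\cdots\times D_N}$ and $\mathcal{K}\subseteq[N]$, $\mathcal{K}^c=[N]\setminus\mathcal{K}$, $[\![\mathcal{A};\mathcal{K}]\!]$ is the matrix arrangement of $\mathcal{A}$ with rows indexed by the axes in $\mathcal{K}$ and columns by the axes in $\mathcal{K}^c$, and $D_{\mathcal{K}}:=\min\{\prod_{n\in\mathcal{K}}D_n,\prod_{n\in\mathcal{K}^c}D_n\}$. The quantum entanglement is $\mathrm{QE}(\mathcal{A};\mathcal{K}):=-\sum_{d=1}^{D_{\mathcal{K}}}\rho_d\ln\rho_d$ where $\rho_d=\sigma_d^2/\sum_{d'}\sigma_{d'}^2$ and $\sigma_1\ge\cdots\ge\sigma_{D_{\mathcal{K}}}$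 are the singular values of $[\![\mathcal{A};\mathcal{K}]\!]$; by convention $\mathrm{QE}(0;\mathcal{K})=0$. The canonical partitions $\mathcal{C}_N$ are the pairs $(\mathcal{K},\mathcal{K}^c)$ with $\mathcal{K}=\{2^{L-l}(n-1)+1,\ldots,2^{L-l}n\}$ for $l\in\{0,\ldots,L\}$, $n\in[2^l]$. The locally connected tensor network of width $R$ is a tensor network whose graph is a perfect binary tree with $N$ leaves, the open edge at the $n$-th leaf having dimension $D_n$ and all inner edges having dimension $R$; the tensors it generates are exactly those of the form: choose vectors $\phi^{(0,n)}_r\in\mathbb{R}^{D_n}$ ($n\in[N]$, $r\in[R]$); for $l=1,\ldots,L-1$, $n\in[2^{L-l}]$, $r\in[R]$ set $\phi^{(l,n)}_r=\sum_{i,j\in[R]}a^{(l,n)}_{r,i,j}\,\phi^{(l-1,2n-1)}_i\otimes\phi^{(l-1,2n)}_j$ with arbitrary real coefficients; and $\mathcal{W}_{\mathrm{TN}}=\sum_{i,j\in[R]}a_{i,j}\,\phi^{(L-1,1)}_i\otimes\phi^{(L-1,2)}_j$. *)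

(* Defs.v *)
From HB Require Import structures.
From mathcomp Require Import all_boot all_order all_algebra.
From mathcomp Require Import reals exp.

Set Implicit Arguments.
Unset Strict Implicit.
Unset Printing Implicit Defensive.

Import Order.TTheory GRing.Theory Num.Theory.
Local Open Scope ring_scope.

Section Tensors.
Variable R : realType.
Variable N : nat.
Variable D : 'I_N -> nat.

Definition Idx := {dffun forall n : 'I_N, 'I_(D n)}.
Definition tensor := Idx -> R.

Definition tnorm (A : tensor) : R := Num.sqrt (\sum_(x : Idx) A x ^+ 2).

(* Row (resp. column) multi-indices of [[A; K]]: coordinates in K (resp. K^c);
   the other coordinates range over the one-element type 'I_1. *)
Definition RowIdx (K : {set 'I_N}) :=
  {dffun forall n : 'I_N, 'I_(if n \in K then D n else 1)}.
Definition ColIdx (K : {set 'I_N}) :=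
  {dffun forall n : 'I_N, 'I_(if n \in K then 1 else D n)}.

Definition merge_coord (b : bool) (d : nat)
    (x : 'I_(if b then d else 1)) (y : 'I_(if b then 1 else d)) : 'I_d :=
  (if b as b' return 'I_(if b' then d else 1) -> 'I_(if b' then 1 else d) -> 'I_d
   then fun x _ => x else fun _ y => y) x y.

Definition merge (K : {set 'I_N}) (r : RowIdx K) (c : ColIdx K) : Idx :=
  @finfun _ (fun n => 'I_(D n)) (fun n => merge_coord (r n) (c n)).

Definition matricize (A : tensor) (K : {set 'I_N}) :
    'M[R]_(#|{: RowIdx K}|, #|{: ColIdx K}|) :=
  \matrix_(i, j) A (merge (enum_val i) (enum_val j)).

(* Canonical partitions C_N for N = 2^L (0-based version of
   K = {2^{L-l}(n-1)+1, ..., 2^{L-l} n}, l in {0..L}, n in [2^l]). *)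
Definition canonical_partition (L : nat) (K : {set 'I_N}) : Prop :=
  exists l n : nat, (l <= L)%N /\ (n < 2 ^ l)%N /\
    K = [set i : 'I_N | (2 ^ (L - l) * n <= i)%N && (i < 2 ^ (L - l) * n.+1)%N].

End Tensors.

Section SVD.
Variable R : realType.

Definition is_singular_values (p q : nat) (M : 'M[R]_(p, q))
    (s : 'I_(minn p q) -> R) : Prop :=
  (forall k, 0 <= s k) /\
  (forall k k' : 'I_(minn p q), (k <= k')%N -> s k' <= s k) /\
  exists (U : 'M[R]_p) (V : 'M[R]_q),
    U^T *m U = 1%:M /\ V^T *m V = 1%:M /\
    M = \sum_(k < minn p q)
          s k *: (col (widen_ord (geq_minl p q) k) U
                  *m (col (widen_ord (geq_minr p q) k) V)^T).

(* Entanglement entropy computed from singular values s: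
   - sum_d rho_d ln rho_d, rho_d = s_d^2 / sum_d' s_d'^2
   (0 ln 0 = 0 automatically; all-zero s gives 0). *)
Definition qentropy (m : nat) (s : 'I_m -> R) : R :=
  let tot := \sum_(k < m) s k ^+ 2 in
  - \sum_(k < m) (s k ^+ 2 / tot) * ln (s k ^+ 2 / tot).

End SVD.

(* Quantum entanglement QE(A;K) <= b, stated for the singular values of [[A;K]]
   (which are unique, so quantifying over every SVD is the same as using "the" ones). *)
Definition QE_le (R : realType) N (D : 'I_N -> nat) (A : tensor R D)
    (K : {set 'I_N}) (b : R) : Prop :=
  forall s, is_singular_values (matricize A K) s -> qentropy s <= b.

Section TN.
Variable R : realType.
Variable N : nat.
Variable D : 'I_N -> nat.
Variable W : nat.

Definition leafval (v : forall n : 'I_N, 'I_W -> 'I_(D n) -> R)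
    (n : nat) (r : 'I_W) (x : Idx D) : R :=
  match (insub n : option 'I_N) with
  | Some m => v m r (x m)
  | None => 0
  end.

(* phi^{(l,n)}_r (0-based n), as a tensor depending only on the axes of its
   subtree (2^l n, ..., 2^l (n+1) - 1); the tensor product of factors on
   disjoint axis blocks is their pointwise product on full multi-indices. *)
Fixpoint node (v : forall n : 'I_N, 'I_W -> 'I_(D n) -> R)
    (a : nat -> nat -> 'I_W -> 'I_W -> 'I_W -> R)
    (l n : nat) (r : 'I_W) (x : Idx D) : R :=
  match l with
  | 0 => leafval v n r x
  | l'.+1 => \sum_(i < W) \sum_(j < W)
               a l n r i j * node v a l' n.*2 i x * node v a l' n.*2.+1 j x
  end.

Definition tn_tensor (L : nat) (v : forall n : 'I_N, 'I_W -> 'I_(D n) -> R)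
    (a : nat -> nat -> 'I_W -> 'I_W -> 'I_W -> R) (atop : 'I_W -> 'I_W -> R)
    : tensor R D :=
  fun x => \sum_(i < W) \sum_(j < W)
             atop i j * node v a L.-1 0 i x * node v a L.-1 1 j x.

End TN.

(* Main.v *)
Require Import Defs.
From HB Require Import structures.
From mathcomp Require Import all_boot all_order all_algebra fingroup perm.
From mathcomp Require Import boolp reals exp.
From mathcomp Require Import complex ring lra zify.
Import Order.TTheory GRing.Theory Num.Theory.
Local Open Scope ring_scope.
Set Implicit Arguments.
Unset Strict Implicit.
Unset Printing Implicit Defensive.

(** For each node [t] of the tree let [P_t] be the orthogonal projection of the
    axes below [t] on the span of the [W] leading left singular vectors of the
    corresponding matricization. The k-th normalized squared singular value is
    at most [1/k], so small entanglement bounds the truncation error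
    [|A - P_t A|^2] by [eps^2 / (2N - 3)]. Pythagoras gives
    [|A - P_t X|^2 <= |A - P_t A|^2 + |A - X|^2], hence a product of projections
    costs at most the sum of the individual errors. The product is taken
    root-first over all non-root nodes except the right child of the root (whose
    cut is that of the left child), i.e. over [2N - 3] nodes. The result is
    generated by the network: projecting on the two children of a node expands
    each of its [W] vectors in the products of the children's vectors, and the
    remaining projections act on the two factors separately. *)

(** * Singular value decomposition *)

Section SVDExistence.
Variable R : rcfType.

Lemma row_sqr_ge0 n (v : 'rV[R]_n) : 0 <= (v *m v^T) 0 0.
Proof. by rewrite mxE sumr_ge0 // => i _; rewrite mxE -expr2 sqr_ge0. Qed.

Lemma row_sqr_eq0 n (v : 'rV[R]_n) : ((v *m v^T) 0 0 == 0) = (v == 0).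
Proof.
apply/idP/eqP => [|->]; last by rewrite mul0mx mxE.
rewrite mxE psumr_eq0 => [/allP h|i _]; last by rewrite mxE -expr2 sqr_ge0.
apply/rowP => i; apply/eqP; rewrite mxE -sqrf_eq0.
by have := h i (mem_index_enum _); rewrite mxE -expr2.
Qed.

Lemma unit_multiple n (v : 'rV[R]_n) : v != 0 ->
  exists2 c : R, c != 0 & (c *: v) *m (c *: v)^T = 1%:M.
Proof.
move=> v0; have [t vE] : exists t, v *m v^T = t%:M by exists ((v *m v^T) 0 0); exact: mx11_scalar.
have vv : 0 < t.
  have <- : (v *m v^T) 0 0 = t by rewrite vE mxE eqxx mulr1n.
  by rewrite lt_def row_sqr_eq0 v0 row_sqr_ge0.
exists (Num.sqrt t)^-1; first by rewrite invr_eq0 gt_eqF ?sqrtr_gt0.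
rewrite linearZ /= -scalemxAl -scalemxAr scalerA -invfM -expr2 sqr_sqrtr 1?ltW //.
by rewrite vE scale_scalar_mx mulVf ?gt_eqF.
Qed.

(** The complexified matrix has an eigenvector [a + ib]. Symmetry makes its eigenvalue real, so
    whichever of [a] and [b] is nonzero is a real eigenvector. *)
Lemma symmetric_eigenvector n (S : 'M[R]_n.+1) : S^T = S ->
  exists (l : R) (v : 'rV[R]_n.+1), v != 0 /\ v *m S = l *: v.
Proof.
move=> symS; pose SC := map_mx (real_complex R) S.
have [z /eigenvalueP [w wz w0]] : exists z, eigenvalue SC z.
  have /closed_rootP [z zr] : size (char_poly SC) != 1%N by rewrite size_char_poly.
  by exists z; rewrite eigenvalue_root_char.
pose a := map_mx (@complex.Re R) w; pose b := map_mx (@complex.Im R) w.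
have ReM (x y : R[i]) :
  complex.Re (x * y) = complex.Re x * complex.Re y - complex.Im x * complex.Im y.
  by case: x y => [? ?] [].
have ImM (x y : R[i]) :
  complex.Im (x * y) = complex.Im x * complex.Re y + complex.Re x * complex.Im y.
  by case: x y => [? ?] [? ?]; rewrite /= addrC.
have aS : a *m S = complex.Re z *: a - complex.Im z *: b.
  apply/rowP => j; have /rowP/(_ j) := wz; rewrite !mxE => /(congr1 (@complex.Re R)).
  rewrite raddf_sum /= ReM => <-; apply: eq_bigr => k _.
  by rewrite !mxE ReM /= mulr0 subr0.
have bS : b *m S = complex.Im z *: a + complex.Re z *: b.
  apply/rowP => j; have /rowP/(_ j) := wz; rewrite !mxE => /(congr1 (@complex.Im R)).
  rewrite raddf_sum /= ImM => <-; apply: eq_bigr => k _.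
  by rewrite !mxE ImM /= mulr0 addr0.
have ab0 : (a != 0) || (b != 0).
  rewrite -negb_and; apply: contra w0 => /andP[/eqP a0 /eqP b0].
  apply/eqP/rowP => j; have /rowP/(_ j) := a0; have /rowP/(_ j) := b0.
  by rewrite !mxE; case: (w 0 j) => x y /= -> ->.
(* Comparing [b S a^T] with its transpose [a S b^T] gives [Im z * (|a|^2 + |b|^2) = 0]. *)
have z0 : complex.Im z = 0.
  have := congr1 (fun X => (X *m a^T) 0 0) bS.
  have -> : (b *m S *m a^T) 0 0 = (a *m S *m b^T) 0 0.
    transitivity ((a *m S *m b^T)^T 0 0); last by rewrite mxE.
    by rewrite !trmx_mul trmxK symS mulmxA.
  have ba : b *m a^T = a *m b^T.
    by apply/matrixP => i j; rewrite !mxE; apply: eq_bigr => k _; rewrite !mxE !ord1 mulrC.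
  rewrite aS mulmxBl (mulmxDl (_ *: a)) -!scalemxAl ba => e.
  have : complex.Im z * ((a *m a^T) 0 0 + (b *m b^T) 0 0) = 0.
    move: e; move: (a *m a^T) (b *m b^T) (a *m b^T) => aa bb ab; rewrite !mxE => e.
    by rewrite mulrDr; move: e; lra.
  have aa := row_sqr_ge0 a; have bb := row_sqr_ge0 b.
  move/eqP; rewrite mulf_eq0 => /orP[/eqP//|].
  by rewrite paddr_eq0 // !row_sqr_eq0; case/andP=> /eqP a0 /eqP b0; rewrite a0 b0 eqxx in ab0.
exists (complex.Re z); case/orP: ab0 => h; [exists a | exists b]; split => //.
  by rewrite aS z0 scale0r subr0.
by rewrite bS z0 scale0r add0r.
Qed.

(* [Q] is the Householder reflection exchanging [v] and [delta_mx 0 0]. *)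
Lemma orthogonal_with_row0 n (v : 'rV[R]_n.+1) : v *m v^T = 1%:M ->
  exists2 Q : 'M[R]_n.+1, Q *m Q^T = 1%:M & row 0 Q = v.
Proof.
move=> vv; pose e0 : 'rV[R]_n.+1 := delta_mx 0 0.
have [->|w0] := eqVneq v e0.
  by exists 1%:M; rewrite ?trmx1 ?mulmx1 // row1.
have [w wE] : exists w, w = v - e0 by exists (v - e0).
pose t := (w *m w^T) 0 0.
have t0 : t != 0 by rewrite row_sqr_eq0 wE subr_eq0.
have wwE : w *m w^T = t%:M by rewrite [LHS]mx11_scalar.
pose Q := 1%:M - (2 / t) *: (w^T *m w).
have Qs : Q^T = Q.
  by rewrite /Q linearB linearZ /= trmx1 trmx_mul trmxK.
exists Q.
  rewrite Qs /Q mulmxBl mul1mx mulmxBr mulmx1 -scalemxAl -scalemxAr scalerA.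
  rewrite mulmxA -[w^T *m w *m w^T]mulmxA wwE mul_mx_scalar -scalemxAl scalerA.
  apply/matrixP => i j; rewrite !mxE; move: t t0 {wwE Q Qs} => t t0.
  by move: (\sum_(k < 1) _) => X; field.
rewrite /Q rowE mulmxBr mulmx1 -scalemxAr mulmxA.
have -> : delta_mx 0 0 *m w^T = (w 0 0)%:M.
  by rewrite -rowE; apply/rowP => i; rewrite ord1 !mxE eqxx mulr1n.
(* Both [v] and [e0] are unit vectors, so [|w|^2 = 2 - 2 v_0]. Hence the reflection sends [e0] to
   [e0 + w = v]. *)
have tE : t = - 2 * w 0 0.
  rewrite /t wE linearB /= mulmxBl !mulmxBr vv.
  rewrite /e0 -rowE trmx_delta -colE -rowE.
  by rewrite !mxE !eqxx /= mulr1n; ring.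
rewrite mul_scalar_mx scalerA.
have w00 : w 0 0 != 0 by apply: contra_neq t0 => w00; rewrite tE w00 mulr0.
have -> : 2 / t * w 0 0 = -1 by rewrite tE; field.
by rewrite scaleN1r opprK addrC wE subrK.
Qed.

(* A unit eigenvector [v] of [M^T M]; when its eigenvalue vanishes, [u] is any
   unit vector of the left kernel, which is nonzero because [q <= p]. *)
Lemma singular_pair p q (M : 'M[R]_(p.+1, q.+1)) : (q <= p)%N ->
  exists (u : 'rV[R]_p.+1) (v : 'rV[R]_q.+1) (s : R),
    [/\ u *m u^T = 1%:M, v *m v^T = 1%:M, 0 <= s,
        u *m M = s *: v & v *m M^T = s *: u].
Proof.
move=> qp; have [|l [v0 [v0N0 v0E]]] := @symmetric_eigenvector q (M^T *m M).
  by rewrite trmx_mul trmxK.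
have [c _ vv] := unit_multiple v0N0; set v := c *: v0 in vv.
have vE : v *m M^T *m M = l *: v.
  by rewrite /v -!scalemxAl -mulmxA v0E scalerA mulrC -scalerA.
pose u0 := v *m M^T.
have u0E : u0 *m u0^T = l%:M.
  by rewrite /u0 trmx_mul trmxK mulmxA vE -scalemxAl vv scale_scalar_mx mulr1.
have l0 : 0 <= l by have := row_sqr_ge0 u0; rewrite u0E mxE eqxx mulr1n.
have [l_eq0|lN0] := eqVneq l 0.
  have u00 : u0 = 0 by apply/eqP; rewrite -row_sqr_eq0 u0E l_eq0 mxE mul0rn.
  have kM : kermx M != 0.
    rewrite -mxrank_eq0 mxrank_ker subn_eq0 -ltnNge ltnS.
    (* The unit vector [v] satisfies [v M^T = 0], so the columns of [M] are dependent. *)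
    have : (\rank M < q.+1)%N.
      rewrite ltn_neqAle rank_leq_col andbT; apply/negP => /eqP rM.
      have : row_free M^T by rewrite /row_free mxrank_tr rM.
      move=> rf; have : v = 0 by apply: (row_free_inj rf); rewrite mul0mx -/u0.
      by move=> ve; move: vv; rewrite ve mul0mx => /matrixP/(_ 0 0)/eqP;
        rewrite !mxE /= eq_sym oner_eq0.
    by lia.
  have [i ri] : exists i, row i (kermx M) != 0.
    apply/existsP; rewrite -[[exists _, _]]negbK negb_exists; apply: contra kM => /forallP h.
    by apply/eqP/row_matrixP => i; apply/eqP; rewrite row0 -[_ == _]negbK h.
  have [d _ uu] := unit_multiple ri.
  exists (d *: row i (kermx M)), v, 0; split; rewrite ?scale0r //.
  by rewrite -scalemxAl -row_mul mulmx_ker row0 scaler0.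
have lp : 0 < l by rewrite lt_def lN0.
have sN0 : Num.sqrt l != 0 by rewrite gt_eqF // sqrtr_gt0.
exists ((Num.sqrt l)^-1 *: u0), v, (Num.sqrt l); split => //.
- rewrite linearZ /= -scalemxAl -scalemxAr scalerA u0E -invfM -expr2 sqr_sqrtr //.
  by rewrite scale_scalar_mx mulVf.
- by rewrite sqrtr_ge0.
- by rewrite -scalemxAl vE scalerA -{2}[l]sqr_sqrtr // expr2 mulKf.
- by rewrite scalerA mulfV // scale1r.
Qed.

(** Deflation: orthogonal changes of basis move a singular pair to the first basis vectors, the two
    relations of [singular_pair] clear the rest of the first row and column, and the lower right
    block is handled by induction. The values are not yet sorted. *)
Lemma svd_tall p q (M : 'M[R]_(p, q)) : (q <= p)%N ->
  exists (U : 'M[R]_p) (V : 'M[R]_q) (s : nat -> R),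
    [/\ U *m U^T = 1%:M, V *m V^T = 1%:M, forall k, 0 <= s k
      & U *m M *m V^T = \matrix_(i, j) (s i *+ (i == j :> nat))].
Proof.
elim: q p M => [|q IH] [|p] // M.
- move=> _; exists 1%:M, 1%:M, (fun=> 0); split; rewrite ?trmx1 ?mulmx1 //.
  by apply/matrixP => i [].
- move=> _; exists 1%:M, 1%:M, (fun=> 0); split; rewrite ?trmx1 ?mulmx1 //.
  by apply/matrixP => i [].
rewrite ltnS => qp.
have [u [v [s [uu vv s0 uM vM]]]] := singular_pair M qp.
have [Qu QuO Qu0] := orthogonal_with_row0 uu.
have [Qv QvO Qv0] := orthogonal_with_row0 vv.
have [B Bdef] : exists B : 'M[R]_(1 + p, 1 + q), B = Qu *m M *m Qv^T by exists (Qu *m M *m Qv^T).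
have B0j j : B 0 j = s *+ (0 == j).
  have -> : B 0 j = (row 0 Qu *m M *m Qv^T) 0 j by rewrite Bdef -!row_mul [RHS]mxE.
  rewrite Qu0 uM -Qv0 -scalemxAl -row_mul QvO !mxE.
  by rewrite mulr_natr.
have Bi0 i : B i 0 = s *+ (i == 0).
  have -> : B i 0 = (row 0 Qv *m M^T *m Qu^T) 0 i.
    have tB : Qv *m M^T *m Qu^T = B^T by rewrite Bdef !trmx_mul trmxK mulmxA.
    by rewrite -!row_mul tB [RHS]mxE [RHS]mxE.
  rewrite Qv0 vM -Qu0 -scalemxAl -row_mul QuO !mxE.
  by rewrite mulr_natr eq_sym.
have BE : B = block_mx s%:M 0 0 (drsubmx B).
  rewrite -{1}[B]submxK; congr block_mx.
  - by apply/matrixP => i j; rewrite !ord1 !mxE lshift0 B0j.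
  - by apply/matrixP => i j; rewrite !ord1 !mxE lshift0 B0j.
  - by apply/matrixP => i j; rewrite !ord1 !mxE lshift0 Bi0.
have [U' [V' [s' [UU VV s'0 UMV]]]] := IH p (drsubmx B) qp.
pose ext n (Q : 'M[R]_n) : 'M[R]_(1 + n) := block_mx 1%:M 0 0 Q.
have orth n (Q' : 'M[R]_n) (Q : 'M[R]_(1 + n)) : Q' *m Q'^T = 1%:M -> Q *m Q^T = 1%:M ->
    (ext n Q' *m Q) *m (ext n Q' *m Q)^T = 1%:M.
  move=> h1 h2; rewrite trmx_mul mulmxA -[_ *m Q *m Q^T]mulmxA h2 mulmx1.
  rewrite tr_block_mx mulmx_block !trmx0 !mul0mx !mulmx0 trmx1 mulmx1 h1 !addr0 add0r.
  by rewrite -scalar_mx_block.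
exists (ext p U' *m Qu), (ext q V' *m Qv).
exists (fun k => if k is k'.+1 then s' k' else s); split.
- exact: orth.
- exact: orth.
- by case.
have -> : (ext p U' *m Qu) *m M *m (ext q V' *m Qv)^T = ext p U' *m B *m (ext q V')^T.
  by rewrite Bdef trmx_mul !mulmxA.
rewrite BE tr_block_mx !mulmx_block !trmx0 trmx1 !(mul0mx, mulmx0, mulmx1, mul1mx, addr0, add0r).
rewrite UMV; apply/matrixP => i j.
rewrite [RHS]mxE; case: (@split_ordP 1 p i) => i' ->; case: (@split_ordP 1 q j) => j' ->.
- by apply: etrans (block_mxEul _ _ _ _ _ _) _; rewrite !ord1 mxE.
- by apply: etrans (block_mxEur _ _ _ _ _ _) _; rewrite !ord1 mxE.
- by apply: etrans (block_mxEdl _ _ _ _ _ _) _; rewrite !ord1 mxE.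
- by apply: etrans (block_mxEdr _ _ _ _ _ _) _; rewrite mxE.
Qed.

Lemma svd_diag p q (M : 'M[R]_(p, q)) :
  exists (U : 'M[R]_p) (V : 'M[R]_q) (s : nat -> R),
    [/\ U *m U^T = 1%:M, V *m V^T = 1%:M, forall k, 0 <= s k
      & U *m M *m V^T = \matrix_(i, j) (s i *+ (i == j :> nat))].
Proof.
have [|/ltnW pq] := leqP q p; first exact: svd_tall.
have [U [V [s [UU VV s0 E]]]] := svd_tall M^T pq.
exists V, U, s; split => //; move: (congr1 trmx E); rewrite !trmx_mul !trmxK mulmxA => ->.
by apply/matrixP => i j; rewrite !mxE eq_sym; case: eqP => // ->.
Qed.

End SVDExistence.

(** Sorting the singular values must also permute the columns of [U] and [V], which can be more
    numerous; the surplus indices stay fixed. *)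
Lemma perm_widen m p (lemp : (m <= p)%N) (s : {perm 'I_m}) :
  exists t : {perm 'I_p}, forall k, t (widen_ord lemp k) = widen_ord lemp (s k).
Proof.
pose f (i : 'I_p) := if insub (i : nat) is Some k then widen_ord lemp (s k) else i.
have fE (k : 'I_m) : f (widen_ord lemp k) = widen_ord lemp (s k).
  by rewrite /f insubT //= => h; congr (widen_ord _ (s _)); apply: val_inj.
have wI (k k' : 'I_m) : widen_ord lemp k = widen_ord lemp k' -> k = k'.
  by move=> e; apply/val_inj; exact: (congr1 val e).
have fI : injective f.
  have E (i : 'I_p) : (exists k : 'I_m, i = widen_ord lemp k) \/ (m <= i)%N /\ f i = i.
    rewrite /f; case: insubP => [k _ ki|]; first by left; exists k; apply: val_inj.
    by rewrite -leqNgt; right.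
  move=> i j; case: (E i) => [[k ->]|[mi fi]]; case: (E j) => [[k' ->]|[mj fj]].
  - by rewrite !fE => /wI /perm_inj ->.
  - by rewrite fE fj => e; move: mj; rewrite -e leqNgt /= ltn_ord.
  - by rewrite fE fi => e; move: mi; rewrite e leqNgt /= ltn_ord.
  - by rewrite fi fj.
by exists (perm fI) => k; rewrite permE.
Qed.

Lemma sorting_perm (R : rcfType) m (s : 'I_m -> R) :
  exists t : {perm 'I_m}, forall k k' : 'I_m, (k <= k')%N -> s (t k') <= s (t k).
Proof.
have st : size (sort (fun x y => y <= x) (codom s)) == m.
  by rewrite size_sort size_codom card_ord.
have /tuple_permP [t tE] : perm_eq (Tuple st) [tuple s i | i < m].
  by rewrite /= perm_sort codomE -val_ord_tuple perm_refl.
exists t => k k' kk'.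
have E (i : 'I_m) : s (t i) = nth 0 (Tuple st) i.
  by rewrite tE -tnth_nth !tnth_mktuple.
rewrite !E /=; apply: (@sorted_leq_nth _ (fun x y : R => y <= x)) => //.
- by move=> y x z h1 h2; exact: le_trans h2 h1.
- by apply: sort_sorted => x y; exact: le_total.
- by rewrite inE (eqP st).
- by rewrite inE (eqP st).
Qed.

(** [QE_le] quantifies over all lists of singular values, so it yields a bound only once such a list
    is known to exist. *)
Lemma singular_values_exist (R : realType) p q (M : 'M[R]_(p, q)) :
  exists s, is_singular_values M s.
Proof.
have [U [V [s [UU VV s0 E]]]] := svd_diag M.
have [t tP] := sorting_perm (fun k : 'I_(minn p q) => s k).
have [tp tpE] := perm_widen (geq_minl p q) t.
have [tq tqE] := perm_widen (geq_minr p q) t.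
exists (fun k => s (t k)); split; [by [] | split; first exact: tP].
exists (col_perm tp U^T), (col_perm tq V^T); split; [|split].
- by rewrite col_permE trmx_mul mulmxA -[_ *m _ *m U^T]mulmxA trmxK UU mulmx1 tr_perm_mx
  -perm_mxM mulVg perm_mx1.
- by rewrite col_permE trmx_mul mulmxA -[_ *m _ *m V^T]mulmxA trmxK VV mulmx1 tr_perm_mx
  -perm_mxM mulVg perm_mx1.
have -> : M = U^T *m (\matrix_(i, j) (s i *+ (i == j :> nat))) *m V.
  by rewrite -E !mulmxA (mulmx1C UU) mul1mx -mulmxA (mulmx1C VV) mulmx1.
have -> : \matrix_(i < p, j < q) (s i *+ (i == j :> nat)) =
    \sum_(k < minn p q) s k *: (delta_mx (widen_ord (geq_minl p q) k) 0 *m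
      delta_mx (0 : 'I_1) (widen_ord (geq_minr p q) k)).
  apply/matrixP => i j; rewrite mxE summxE.
  under eq_bigr => k _ do rewrite mul_delta_mx !mxE -!val_eqE /=.
  have [ij|ij] := eqVneq (i : nat) j.
    have im : (i < minn p q)%N by rewrite leq_min ltn_ord /= ij ltn_ord.
    rewrite (bigD1 (Ordinal im)) //= -ij eqxx mulr1 big1 ?addr0 // => k ki.
    by rewrite andbb [_ == k :> nat](negbTE _) ?mulr0 // eq_sym.
  rewrite big1 // => k _; case: eqP => [ik|]; last by rewrite mulr0.
  by case: eqP => [jk|]; [rewrite ik jk eqxx in ij | rewrite mulr0].
rewrite mulmx_sumr mulmx_suml (reindex_inj (@perm_inj _ t)) /=; apply: eq_bigr => k _.
rewrite -scalemxAr -scalemxAl; congr (_ *: _); rewrite !mulmxA -colE -mulmxA -rowE.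
by congr (_ *m _); apply/matrixP => i j; rewrite !mxE ?tpE ?tqE.
Qed.

(** * Entropy *)

Section EntropyTail.
Variable R : realType.

(* The k-th largest of numbers summing to 1 is at most 1/k, so every term of
   index at least [W] has [- ln rho >= ln (W + 1)]. *)
Lemma entropy_tail m (s : 'I_m -> R) (W : nat) :
  (forall k, 0 <= s k) -> (forall k k' : 'I_m, (k <= k')%N -> s k' <= s k) ->
  (\sum_(k < m | (W <= k)%N) s k ^+ 2) * ln (W.+1%:R)
    <= (\sum_k s k ^+ 2) * qentropy s.
Proof.
move=> s0 sd; rewrite /qentropy; set T := \sum_k s k ^+ 2.
have T0 : 0 <= T by apply: sumr_ge0 => k _; rewrite sqr_ge0.
have sT k : s k ^+ 2 <= T.
  by rewrite /T (bigD1 k) //= lerDl sumr_ge0 // => j _; rewrite sqr_ge0.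
have [T_eq0|TN0] := eqVneq T 0.
  rewrite T_eq0 mul0r big1 ?mul0r // => k _; apply/le_anti.
  by rewrite sqr_ge0 -T_eq0 sT.
have Tp : 0 < T by rewrite lt_def TN0.
rewrite -sumrN mulr_sumr mulr_suml.
rewrite [X in _ <= X](bigID (fun k : 'I_m => (W <= k)%N)) /= -[X in X <= _]addr0.
have rho1 k : 0 <= s k ^+ 2 / T <= 1.
  by rewrite divr_ge0 ?sqr_ge0 //= ler_pdivrMr // mul1r.
(* The entropy terms of index below [W] are dropped: they are nonnegative because each normalized
   square lies in [[0, 1]]. *)
apply: lerD; last first.
  apply: sumr_ge0 => k _; rewrite mulr_ge0 // -mulrN mulr_ge0 ?oppr_ge0 ?ln_le0 //.
    by case/andP: (rho1 k).
  by case/andP: (rho1 k).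
apply: ler_sum => k Wk.
have [sk0|skN0] := eqVneq (s k) 0; first by rewrite sk0 expr0n /= !mul0r oppr0 mulr0.
have sk2 : 0 < s k ^+ 2 by rewrite exprn_even_gt0.
rewrite -mulrN mulrA [T * _]mulrC divfK // ler_pM2l // -lnV ?posrE ?divr_gt0 //.
rewrite ler_ln ?posrE ?ltr0Sn ?invr_gt0 ?divr_gt0 // invf_div ler_pdivlMr //.
(* Since [s k] is the least of the first [k + 1] values, [(k + 1) s_k^2 <= T], and
   [W + 1 <= k + 1]. *)
apply: (@le_trans _ _ (\sum_(j < m | (j <= k)%N) s j ^+ 2)); last first.
  by rewrite /T [X in _ <= X](bigID (fun j : 'I_m => (j <= k)%N)) /= lerDl sumr_ge0 // => j _;
    rewrite sqr_ge0.
apply: (@le_trans _ _ (\sum_(j < m | (j <= k)%N) s k ^+ 2)); last first.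
  by apply: ler_sum => j jk; rewrite ler_sqr ?nnegrE ?sd.
rewrite sumr_const -[X in _ <= X]mulr_natl ler_pM2r // ler_nat.
have -> : #|[pred j : 'I_m | (j <= k)%N]| = k.+1.
  rewrite -sum1_card (eq_bigl (fun j : 'I_m => (j < k.+1)%N)) //.
  by rewrite -(big_ord_widen m (fun=> 1%N)) // sum_nat_const card_ord muln1.
by [].
Qed.

End EntropyTail.

(** * Projections of groups of axes *)

Section Projections.
Variables (R : realType) (N : nat) (D : 'I_N -> nat) (W : nat).
Implicit Types (K : {set 'I_N}) (A B f g : tensor R D) (u : 'I_W -> tensor R D).

(** This replaces the splitting of a multi-index into row and column parts, so that all tensors,
    even those of a few axes, are functions on the one type [Idx D]. *)
Definition mix K (y x : Idx D) : Idx D :=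
  @finfun _ (fun n => 'I_(D n)) (fun n => if n \in K then y n else x n).

Definition depends_on K f := forall x y : Idx D, {in K, forall n, x n = y n} -> f x = f y.

Definition tdot f g : R := \sum_x f x * g x.

(* The orthogonal projection of the axes in [K] on the span of [u]. As [u r]
   is a function of all axes, constant along those outside [K], the sum over
   [y] ranges over full multi-indices; the extra factor is absorbed in the
   normalisation of [u] demanded by [frame]. *)
Definition proj K u A : tensor R D :=
  fun x => \sum_r u r x * \sum_y u r y * A (mix K y x).

(** The Gram condition is weaker than orthonormality: it admits an orthonormal family padded with
    zeros, as happens when [W] exceeds the number of singular values. *)
Definition frame K u :=
  (forall r, depends_on K (u r)) /\
  (forall s x, \sum_r tdot (u r) (u s) * u r x = u s x).

Lemma mixE K y x n : mix K y x n = if n \in K then y n else x n.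
Proof. by rewrite ffunE. Qed.

Lemma depends_mix K f y x : depends_on K f -> f (mix K y x) = f y.
Proof. by move=> fK; apply: fK => n nK; rewrite mixE nK. Qed.

Lemma depends_mixC K K' f y x : depends_on K' f -> [disjoint K & K'] -> f (mix K y x) = f x.
Proof.
move=> fK KK; apply: fK => n nK; rewrite mixE ifN //.
by apply/negP => nK1; have := disjointFr KK nK1; rewrite nK.
Qed.

Lemma depends_on_sub K K' f : K \subset K' -> depends_on K f -> depends_on K' f.
Proof. by move=> /subsetP KK fK x y xy; apply: fK => n nK; apply/xy/KK. Qed.

Lemma tdotC f g : tdot f g = tdot g f.
Proof. by apply: eq_bigr => x _; rewrite mulrC. Qed.

Lemma tdot_ge0 f : 0 <= tdot f f.
Proof. by apply: sumr_ge0 => x _; rewrite -expr2 sqr_ge0. Qed.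

Lemma eq_tdot f f' g g' : f =1 f' -> g =1 g' -> tdot f g = tdot f' g'.
Proof. by move=> ff gg; apply: eq_bigr => x _; rewrite ff gg. Qed.

Lemma tdotBl f f' g : tdot (fun x => f x - f' x) g = tdot f g - tdot f' g.
Proof. by rewrite -sumrB; apply: eq_bigr => x _; rewrite mulrBl. Qed.

Lemma tdotBr f g g' : tdot f (fun x => g x - g' x) = tdot f g - tdot f g'.
Proof. by rewrite -sumrB; apply: eq_bigr => x _; rewrite mulrBr. Qed.

Lemma eq_proj K u A B : A =1 B -> proj K u A =1 proj K u B.
Proof.
move=> AB x; apply: eq_bigr => r _; congr (_ * _); apply: eq_bigr => y _.
by rewrite AB.
Qed.

Lemma proj_sum (I : finType) (c : I -> R) (h : I -> tensor R D) K u x :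
  proj K u (fun x => \sum_i c i * h i x) x = \sum_i c i * proj K u (h i) x.
Proof.
rewrite /proj; under [RHS]eq_bigr => i _ do rewrite mulr_sumr.
rewrite [RHS]exchange_big; apply: eq_bigr => r _ /=.
under [RHS]eq_bigr => i _ do rewrite mulrCA.
rewrite -mulr_sumr; congr (_ * _).
under [RHS]eq_bigr => i _ do rewrite mulr_sumr.
rewrite [RHS]exchange_big; apply: eq_bigr => y _ /=.
by rewrite mulr_sumr; apply: eq_bigr => i _; rewrite mulrCA.
Qed.

Lemma proj_mull K K' u f g x : depends_on K' f -> [disjoint K & K'] ->
  proj K u (fun x => f x * g x) x = f x * proj K u g x.
Proof.
move=> fK KK; rewrite [RHS]mulr_sumr; apply: eq_bigr => r _.
rewrite [RHS]mulrCA; congr (_ * _); rewrite mulr_sumr; apply: eq_bigr => y _.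
by rewrite (depends_mixC _ _ fK KK) mulrCA.
Qed.

Lemma depends_on_proj K K' u f : (forall r, depends_on K (u r)) -> K \subset K' ->
  depends_on K' f -> depends_on K' (proj K u f).
Proof.
move=> uK KK fK x y xy; apply: eq_bigr => r _.
rewrite (depends_on_sub KK (uK r) xy); congr (_ * _); apply: eq_bigr => z _.
congr (_ * _); apply: fK => n nK; rewrite !mixE; case: ifP => // _.
exact: xy.
Qed.

Lemma mixK K (x y : Idx D) : mix K (mix K x y) (mix K y x) = x.
Proof. by apply/ffunP => n; rewrite !mixE; case: (n \in K). Qed.

Lemma proj_sym K u A B : (forall r, depends_on K (u r)) ->
  tdot A (proj K u B) = tdot (proj K u A) B.
Proof.
move=> uK.
have E f g : tdot f (proj K u g) = \sum_(p : Idx D * Idx D) \sum_r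
    f p.1 * u r p.1 * u r p.2 * g (mix K p.2 p.1).
  rewrite -(pair_bigA _ (fun x y => \sum_r f x * u r x * u r y * g (mix K y x))).
  apply: eq_bigr => x _; rewrite [RHS]exchange_big mulr_sumr; apply: eq_bigr => r _ /=.
  by rewrite mulrA mulr_sumr; apply: eq_bigr => y _; rewrite mulrA.
rewrite [RHS]tdotC !E.
(* Exchanging the [K]-coordinates of [x] and [y] is an involution on pairs that swaps the roles of
   [A] and [B]. *)
rewrite (reindex (fun p : Idx D * Idx D => (mix K p.2 p.1, mix K p.1 p.2))) /=; last first.
  by exists (fun p => (mix K p.2 p.1, mix K p.1 p.2)) => -[x y] _ /=; rewrite !mixK.
apply: eq_bigr => -[x y] _ /=; apply: eq_bigr => r _.
rewrite mixK !(depends_mix _ _ (uK r)); ring.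
Qed.

(** Projecting twice applies the Gram matrix of [u] to the coefficients of the first projection; the
    frame condition absorbs it. *)
Lemma proj_idem K u A : frame K u -> proj K u (proj K u A) =1 proj K u A.
Proof.
move=> [uK uE] x; rewrite {1}/proj.
pose c s := \sum_z u s z * A (mix K z x).
have E y : proj K u A (mix K y x) = \sum_s u s y * c s.
  apply: eq_bigr => s _; rewrite (depends_mix _ _ (uK s)); congr (_ * _).
  apply: eq_bigr => z _; congr (_ * A _); apply/ffunP => n; rewrite !mixE.
  by case: (n \in K).
transitivity (\sum_r \sum_s tdot (u r) (u s) * u r x * c s); last first.
  rewrite exchange_big; apply: eq_bigr => s _ /=; rewrite -mulr_suml.
  by rewrite uE.
apply: eq_bigr => r _; under eq_bigr => y _ do rewrite E mulr_sumr.
rewrite exchange_big mulr_sumr; apply: eq_bigr => s _ /=.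
rewrite [in RHS]mulrAC -[RHS]mulrC; congr (_ * _); rewrite mulr_suml.
by apply: eq_bigr => y _; rewrite mulrA.
Qed.

Lemma tdot_subsq f g :
  tdot (fun x => f x - g x) (fun x => f x - g x) = tdot f f - 2 * tdot f g + tdot g g.
Proof. by rewrite tdotBl !tdotBr [tdot g f]tdotC; ring. Qed.

(** [A - P X = (A - P A) + P (A - X)] is an orthogonal sum, and [P] does not increase norms. *)
Lemma proj_error K u A X : frame K u ->
  tdot (fun x => A x - proj K u X x) (fun x => A x - proj K u X x) <=
  tdot (fun x => A x - proj K u A x) (fun x => A x - proj K u A x) +
  tdot (fun x => A x - X x) (fun x => A x - X x).
Proof.
move=> fr; have uK := proj1 fr; set P := proj K u.
have PP f g : tdot (P f) (P g) = tdot f (P g).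
  by rewrite -(proj_sym _ _ uK); apply: eq_tdot => // x; exact: proj_idem.
have XA : tdot X (P A) = tdot A (P X) by rewrite (proj_sym _ _ uK) tdotC.
(* As [P] is symmetric and idempotent, the gap between the two sides of the claim is
   [|(A - X) - P (A - X)|^2]. *)
have := tdot_ge0 (fun x => (A x - X x) - (P A x - P X x)).
rewrite (tdot_subsq (fun x => A x - X x)) !(tdot_subsq A) (tdot_subsq (P A)).
rewrite tdotBl !tdotBr.
by rewrite !PP XA; lra.
Qed.

(** * Products of projections *)

Section ProjectionSequence.
Variables (I : eqType) (K : I -> {set 'I_N}) (u : I -> 'I_W -> tensor R D).

Definition projs (s : seq I) A : tensor R D := foldr (fun i => proj (K i) (u i)) A s.

Lemma projs_cat s t A : projs (s ++ t) A = projs s (projs t A).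
Proof. exact: foldr_cat. Qed.

Lemma eq_projs s A B : A =1 B -> projs s A =1 projs s B.
Proof. by move=> AB; elim: s => //= i s IH; apply: eq_proj. Qed.

(** The head of [s] acts last. Taking for [X] in [proj_error] the result of the tail charges the
    head with its error on the original [A], so the errors add up. *)
Lemma projs_error s A (d : R) :
  (forall i, i \in s -> frame (K i) (u i) /\
    tdot (fun x => A x - proj (K i) (u i) A x) (fun x => A x - proj (K i) (u i) A x) <= d) ->
  tdot (fun x => A x - projs s A x) (fun x => A x - projs s A x) <= (size s)%:R * d.
Proof.
elim: s => [|i s IH] h /=.
  by rewrite mul0r /tdot big1 // => x _; rewrite subrr mul0r.
have [fr Ed] := h i (mem_head _ _).
apply: le_trans (proj_error A _ fr) _; rewrite -natr1 mulrDl mul1r addrC.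
by apply: lerD Ed; apply: IH => j js; apply: h; rewrite inE js orbT.
Qed.

Lemma projs_sum (J : finType) (c : J -> R) (h : J -> tensor R D) s x :
  projs s (fun x => \sum_j c j * h j x) x = \sum_j c j * projs s (h j) x.
Proof. by elim: s x => //= i s IH x; rewrite (eq_proj _ _ IH) proj_sum. Qed.

Lemma projs_mull s K' f g x : depends_on K' f -> (forall i, i \in s -> [disjoint K i & K']) ->
  projs s (fun x => f x * g x) x = f x * projs s g x.
Proof.
move=> fK; elim: s x => //= i s IH x h; rewrite -(proj_mull _ _ _ fK) ?h ?mem_head //.
by apply: eq_proj => {}x; apply: IH => j js; apply: h; rewrite inE js orbT.
Qed.

Lemma depends_on_projs s K' f : (forall i, i \in s -> K i \subset K') ->
  (forall i r, depends_on (K i) (u i r)) -> depends_on K' f -> depends_on K' (projs s f).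
Proof.
move=> h uK fK; elim: s h => //= i s IH h; apply: depends_on_proj => //.
  by rewrite h ?mem_head.
by apply: IH => j js; apply: h; rewrite inE js orbT.
Qed.

End ProjectionSequence.

(** The bracket is the coordinate of [f] along the product of [u1 i] and [u2 j]. It is free of [x]
    because [f] involves only the two groups of axes; such brackets become the network
    coefficients. *)
Lemma proj2E K1 K2 u1 u2 f x : [disjoint K1 & K2] -> depends_on (K1 :|: K2) f ->
  (forall r, depends_on K1 (u1 r)) -> (forall r, depends_on K2 (u2 r)) ->
  proj K1 u1 (proj K2 u2 f) x =
  \sum_i \sum_j (\sum_z \sum_y u1 i z * u2 j y * f (mix K2 y z)) * u1 i x * u2 j x.
Proof.
move=> KK fK u1K u2K; apply: eq_bigr => i _.
transitivity (u1 i x * \sum_j \sum_z \sum_y u1 i z * u2 j y * f (mix K2 y z) * u2 j x).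
  congr (_ * _); rewrite exchange_big; apply: eq_bigr => z _ /=.
  rewrite mulr_sumr; apply: eq_bigr => j _.
  rewrite (depends_mixC _ _ (u2K j) KK) !mulr_sumr; apply: eq_bigr => y _.
  have -> : f (mix K2 y (mix K1 z x)) = f (mix K2 y z).
    apply: fK => n; rewrite !inE !mixE; case: (n \in K2) => //.
    by rewrite orbF => ->.
  ring.
rewrite mulr_sumr; apply: eq_bigr => j _; rewrite -mulrA [RHS]mulrCA; congr (_ * _).
rewrite mulr_suml; apply: eq_bigr => z _; rewrite mulr_suml; apply: eq_bigr => y _.
by [].
Qed.

End Projections.

(** * Truncation of one matricization *)

Section Unmerge.
Variables (R : realType) (N : nat) (D : 'I_N -> nat) (K : {set 'I_N}).

Definition row_coord (b : bool) (d : nat) (x : 'I_d) : 'I_(if b then d else 1) :=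
  if b as b' return 'I_(if b' then d else 1) then x else ord0.

Definition col_coord (b : bool) (d : nat) (x : 'I_d) : 'I_(if b then 1 else d) :=
  if b as b' return 'I_(if b' then 1 else d) then ord0 else x.

Definition row_of (x : Idx D) : RowIdx D K :=
  @finfun _ (fun n => 'I_(if n \in K then D n else 1)) (fun n => row_coord (n \in K) (x n)).

Definition col_of (x : Idx D) : ColIdx D K :=
  @finfun _ (fun n => 'I_(if n \in K then 1 else D n)) (fun n => col_coord (n \in K) (x n)).

Lemma merge_split x : Defs.merge (row_of x) (col_of x) = x.
Proof. by apply/ffunP => n; rewrite !ffunE; case: (n \in K). Qed.

Lemma row_of_merge (r : RowIdx D K) (c : ColIdx D K) : row_of (Defs.merge r c) = r.
Proof.
apply/ffunP => n; rewrite !ffunE; move: (r n) (c n).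
by case: (n \in K) => //= i j; rewrite (ord1 i).
Qed.

Lemma col_of_merge (r : RowIdx D K) (c : ColIdx D K) : col_of (Defs.merge r c) = c.
Proof.
apply/ffunP => n; rewrite !ffunE; move: (r n) (c n).
by case: (n \in K) => //= i j; rewrite (ord1 j).
Qed.

Definition row_index x : 'I_#|{: RowIdx D K}| := enum_rank (row_of x).
Definition col_index x : 'I_#|{: ColIdx D K}| := enum_rank (col_of x).

Lemma tensorE (A : tensor R D) x : A x = matricize A K (row_index x) (col_index x).
Proof. by rewrite mxE !enum_rankK merge_split. Qed.

Lemma row_index_mix x y : row_index (mix K y x) = row_index y.
Proof.
congr enum_rank; apply/ffunP => n; rewrite !ffunE.
by case: (n \in K).
Qed.

Lemma col_index_mix x y : col_index (mix K y x) = col_index x.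
Proof.
congr enum_rank; apply/ffunP => n; rewrite !ffunE.
by case: (n \in K).
Qed.

Lemma depends_on_row_index (g : 'I_#|{: RowIdx D K}| -> R) :
  depends_on K (fun x : Idx D => g (row_index x)).
Proof.
move=> x y xy; congr (g (enum_rank _)); apply/ffunP => n; rewrite !ffunE.
by have := xy n; case: (n \in K) => // ->.
Qed.

Lemma sum_row_col (f : 'I_#|{: RowIdx D K}| -> 'I_#|{: ColIdx D K}| -> R) :
  \sum_(x : Idx D) f (row_index x) (col_index x) = \sum_i \sum_j f i j.
Proof.
rewrite pair_bigA (reindex (fun x : Idx D => (row_index x, col_index x))) //=.
exists (fun p => Defs.merge (enum_val p.1) (enum_val p.2)) => [x|[i j]] _ /=.
  by rewrite !enum_rankK merge_split.
by rewrite /row_index /col_index row_of_merge col_of_merge !enum_valK.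
Qed.

Lemma card_ColIdx_gt0 : (forall n, (0 < D n)%N) -> (0 < #|{: ColIdx D K}|)%N.
Proof.
move=> D0; have D1 n : (0 < if n \in K then 1 else D n)%N by case: ifP.
apply/card_gt0P; exists (@finfun _ (fun n => 'I_(if n \in K then 1 else D n))
  (fun n => Ordinal (D1 n))).
by [].
Qed.

End Unmerge.

Lemma sum_col_mul (R : realType) p (U : 'M[R]_p) i j :
  U^T *m U = 1%:M -> \sum_k U k i * U k j = (i == j)%:R.
Proof.
move/matrixP/(_ i j); rewrite !mxE => <-; apply: eq_bigr => k _.
by rewrite mxE.
Qed.

(** The rank-one matrices formed from the [k]-th vectors of [U] and [V] are orthonormal. The
    predicate [P] serves both the full norm and the norm of a tail. *)
Lemma sum_sqr_singular (R : realType) p q m (P : pred 'I_m) (s : 'I_m -> R)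
    (U : 'I_p -> 'I_m -> R) (V : 'I_q -> 'I_m -> R) :
  (forall k l, \sum_i U i k * U i l = (k == l)%:R) ->
  (forall k l, \sum_j V j k * V j l = (k == l)%:R) ->
  \sum_i \sum_j (\sum_(k | P k) s k * U i k * V j k) ^+ 2 = \sum_(k | P k) s k ^+ 2.
Proof.
move=> UU VV.
transitivity (\sum_i \sum_j \sum_(k | P k) \sum_(l | P l)
    (s k * s l) * (U i k * U i l) * (V j k * V j l)).
  apply: eq_bigr => i _; apply: eq_bigr => j _; rewrite expr2 big_distrlr /=.
  by apply: eq_bigr => k _; apply: eq_bigr => l _; ring.
under eq_bigr => i _ do rewrite exchange_big.
rewrite exchange_big /=; apply: eq_bigr => k Pk.
under eq_bigr => i _ do rewrite exchange_big.
rewrite exchange_big /= (bigD1 k) //= [X in _ + X]big1 ?addr0 => [|l /andP[_ lk]].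
  under eq_bigr => i _ do rewrite -mulr_sumr VV eqxx mulr1.
  by rewrite -mulr_sumr UU eqxx mulr1 expr2.
by rewrite big1 // => i _; rewrite -mulr_sumr VV eq_sym (negbTE lk) mulr0.
Qed.

(** Projecting on the leading [W] left singular vectors removes the terms of index at least [W],
    whose squares [entropy_tail] bounds. *)
Lemma frame_of_entropy (R : realType) (N : nat) (D : 'I_N -> nat) (W : nat)
    (A : tensor R D) (K : {set 'I_N}) (b : R) :
  (forall n, (0 < D n)%N) -> QE_le A K b ->
  exists u : 'I_W -> tensor R D, frame K u /\
    tdot (fun x => A x - proj K u A x) (fun x => A x - proj K u A x) * ln W.+1%:R
    <= tdot A A * b.
Proof.
move=> D0 QE.
pose p := #|{: RowIdx D K}|; pose q := #|{: ColIdx D K}|; pose m := minn p q.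
have [M ME QEM] : exists2 M : 'M[R]_(p, q),
    (forall x, A x = M (row_index K x) (col_index K x)) &
    (forall s : 'I_m -> R, is_singular_values M s -> qentropy s <= b).
  by exists (matricize A K); [exact: tensorE | exact: QE].
have [s sM] : exists s : 'I_m -> R, is_singular_values M s := singular_values_exist M.
have [s0 [sd [U [V [/sum_col_mul UU [/sum_col_mul VV MUV]]]]]] := sM.
pose u0 i (k : 'I_m) := U i (widen_ord (geq_minl p q) k).
pose v0 j (k : 'I_m) := V j (widen_ord (geq_minr p q) k).
have u0u0 k l : \sum_i u0 i k * u0 i l = (k == l)%:R by rewrite UU.
have v0v0 k l : \sum_j v0 j k * v0 j l = (k == l)%:R by rewrite VV.
have AE x : A x = \sum_k s k * u0 (row_index K x) k * v0 (col_index K x) k.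
  rewrite ME MUV summxE; apply: eq_bigr => k _.
  by rewrite !mxE big_ord_recl big_ord0 addr0 !mxE mulrA.
(* Zero padding beyond the [m]-th singular vector, as [W] may exceed [m]. *)
pose ext (g : 'I_m -> R) (r : nat) := if insub r is Some k then g k else 0.
have extE g (k : 'I_m) : ext g k = g k by rewrite /ext valK.
have ext0 g r : (m <= r)%N -> ext g r = 0 by rewrite leqNgt /ext => h; rewrite insubN.
have sum_ext g : \sum_(r < W) ext g r = \sum_(k < m | (k < W)%N) g k.
  rewrite (big_ord_widen (W + m)) ?leq_addr //.
  under [RHS]eq_bigr => k _ do rewrite -extE.
  rewrite [RHS](big_ord_widen_cond (W + m) (fun k => (k < W)%N) (ext g)) ?leq_addl //.
  rewrite (bigID (fun r : 'I_(W + m) => (r < m)%N)) /= addrC big1 ?add0r // => r.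
  by case/andP => _; rewrite -leqNgt; exact: ext0.
have q0 : (0 < q)%N by exact: card_ColIdx_gt0.
(* Seen as a function of all axes, a singular vector is repeated for each of the [q] column indices,
   so its norm is [c]. *)
pose c : R := Num.sqrt q%:R.
have c0 : c != 0 by rewrite gt_eqF // sqrtr_gt0 ltr0n.
have cc : q%:R = c * c by rewrite -expr2 sqr_sqrtr ?ler0n.
have qE (F : 'I_p -> R) : \sum_i \sum_(j < q) F i = c * c * \sum_i F i.
  rewrite mulr_sumr; apply: eq_bigr => i _.
  by rewrite sumr_const card_ord -cc mulr_natl.
pose u (r : 'I_W) : tensor R D := fun x => ext (u0 (row_index K x)) r / c.
have cK (y z : R) : c * c * (y / c * (z / c)) = y * z by field.
have uu r t : tdot (u r) (u t) = ((r == t) && (r < m)%N)%:R.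
  rewrite /tdot /u.
  rewrite (sum_row_col (fun i _ => ext (u0 i) r / c * (ext (u0 i) t / c))) qE mulr_sumr.
  under eq_bigr => i _ do rewrite cK.
  case: (ltnP r m) => rm; last first.
    by rewrite andbF big1 // => i _; rewrite ext0 // mul0r.
  case: (ltnP t m) => tm; last first.
    rewrite big1 => [|i _]; last by rewrite [ext _ t]ext0 // mulr0.
    by case: eqP => // rt; move: rm; rewrite rt ltnNge tm.
  under eq_bigr => i _ do rewrite (extE _ (Ordinal rm)) (extE _ (Ordinal tm)).
  by rewrite u0u0 andbT.
have fr : frame K u.
  split=> [r|t x]; first exact: (depends_on_row_index (fun i => ext (u0 i) r / c)).
  rewrite (bigD1 t) //= big1 => [|r rt]; last by rewrite uu (negbTE rt) mul0r.
  rewrite uu eqxx addr0 /=; case: (ltnP t m) => tm; first by rewrite mul1r.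
  by rewrite /u ext0 // !mul0r.
have PE x : proj K u A x =
    \sum_(k < m | (k < W)%N) s k * u0 (row_index K x) k * v0 (col_index K x) k.
  rewrite -sum_ext; apply: eq_bigr => r _.
  have -> : \sum_y u r y * A (mix K y x) =
      c * \sum_i ext (u0 i) r * \sum_k s k * u0 i k * v0 (col_index K x) k.
    under eq_bigr => y _ do rewrite AE row_index_mix col_index_mix.
    rewrite (sum_row_col (fun i _ =>
      ext (u0 i) r / c * \sum_k s k * u0 i k * v0 (col_index K x) k)).
    rewrite qE !mulr_sumr; apply: eq_bigr => i _; field.
    exact: c0.
  rewrite /u mulrA divfK //; case: (ltnP r m) => rm; last by rewrite !ext0 // mul0r.
  rewrite !(extE _ (Ordinal rm)).
  under eq_bigr => i _ do rewrite (extE _ (Ordinal rm)) mulr_sumr.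
  rewrite exchange_big (bigD1 (Ordinal rm)) //= [X in _ * (_ + X)]big1 ?addr0 => [|k kr].
    under eq_bigr => i _ do rewrite mulrA mulrCA.
    by rewrite -mulr_suml -mulr_sumr u0u0 eqxx mulr1n; ring.
  under eq_bigr => i _ do rewrite mulrA mulrCA.
  by rewrite -mulr_suml -mulr_sumr u0u0 eq_sym (negbTE kr) mulr0 mul0r.
have EE : tdot (fun x => A x - proj K u A x) (fun x => A x - proj K u A x) =
    \sum_(k < m | (W <= k)%N) s k ^+ 2.
  rewrite -(sum_sqr_singular _ _ u0u0 v0v0) -sum_row_col; apply: eq_bigr => x _.
  rewrite -expr2 PE {1}AE (bigID (fun k : 'I_m => (k < W)%N)) /= addrC addrK.
  by congr (_ ^+ 2); apply: eq_bigl => k; rewrite -leqNgt.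
have AA : tdot A A = \sum_k s k ^+ 2.
  rewrite -(sum_sqr_singular _ _ u0u0 v0v0) -sum_row_col; apply: eq_bigr => x _.
  by rewrite -expr2 {1}AE.
exists u; split => //; rewrite EE AA.
apply: le_trans (entropy_tail W s0 sd) _; rewrite ler_wpM2l ?QEM //.
by apply: sumr_ge0 => k _; rewrite sqr_ge0.
Qed.

(** * Tree tensor networks *)

Section Tree.
Variables (R : realType) (N : nat) (D : 'I_N -> nat) (W : nat).
Implicit Types (l n : nat).

(** The leaves below the node [t], a pair of level and position, with levels counted from the leaves
    as in [node]. *)
Definition block (t : nat * nat) : {set 'I_N} :=
  [set i : 'I_N | (2 ^ t.1 * t.2 <= i)%N && (i < 2 ^ t.1 * t.2.+1)%N].

Lemma block_split l n : block (l.+1, n) = block (l, n.*2) :|: block (l, n.*2.+1).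
Proof.
apply/setP => i; rewrite !inE /= expnS -!muln2.
have -> : (2 * 2 ^ l * n = 2 ^ l * (n * 2))%N by rewrite [(2 * _)%N]mulnC -mulnA [(2 * n)%N]mulnC.
have -> : (2 * 2 ^ l * n.+1 = 2 ^ l * (n * 2).+2)%N by rewrite [(2 * _)%N]mulnC -mulnA; lia.
have : (2 ^ l * (n * 2) <= 2 ^ l * (n * 2).+1 <= 2 ^ l * (n * 2).+2)%N.
  by rewrite !leq_mul2l !leqnSn !orbT.
lia.
Qed.

Lemma block_disjoint l n : [disjoint block (l, n.*2) & block (l, n.*2.+1)].
Proof. by rewrite -setI_eq0; apply/eqP/setP => i; rewrite !inE /=; lia. Qed.

(** In [projs] the end of the list acts first, so the children are placed after their own
    descendants. The node [(l, n)] itself is left out. *)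
Fixpoint descendants l n : seq (nat * nat) :=
  if l is l'.+1 then
    descendants l' n.*2 ++ descendants l' n.*2.+1 ++ [:: (l', n.*2); (l', n.*2.+1)]
  else [::].

Lemma size_descendants l n : size (descendants l n) = (2 ^ l.+1 - 2)%N.
Proof.
elim: l n => //= l IH n; rewrite !size_cat !IH /= !expnS.
have := expn_gt0 2 l; lia.
Qed.

Lemma descendants_block l n t : t \in descendants l n -> block t \subset block (l, n).
Proof.
elim: l n => //= l IH n; rewrite block_split !mem_cat !inE.
case/orP => [/IH h|/orP[/IH h|/orP[/eqP ->|/eqP ->]]]; rewrite ?subsetUl ?subsetUr //.
  exact: subset_trans h (subsetUl _ _).
exact: subset_trans h (subsetUr _ _).
Qed.

(** With [k] the depth of [(l, n)], the whole tree has height [l + k]; descendants stay inside it,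
    so their blocks are canonical. *)
Lemma descendants_range l n t k : t \in descendants l n -> (n < 2 ^ k)%N ->
  (t.1 < l)%N /\ (t.2 < 2 ^ (l + k - t.1))%N.
Proof.
elim: l n k => //= l IH n k; rewrite !mem_cat !inE => tl nk.
have n2 : (n.*2.+1 < 2 ^ k.+1)%N by rewrite expnS; lia.
case/orP: tl => [tl|/orP[tl|tl]].
- have [h1 h2] := IH _ k.+1 tl (ltnW n2); split; first exact: ltnW.
  by rewrite addSnnS.
- have [h1 h2] := IH _ k.+1 tl n2; split; first exact: ltnW.
  by rewrite addSnnS.
- by case/orP: tl => /eqP -> /=; rewrite addSnnS addKn; split => //; lia.
Qed.

Variable F : nat * nat -> 'I_W -> tensor R D.
Hypothesis FK : forall t r, depends_on (block t) (F t r).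

(** A projection from [s1] acts on axes in [K1] and treats the factors living on [K2] as constants,
    and symmetrically for [s2]; linearity does the rest. *)
Lemma projs_product (K1 K2 : {set 'I_N}) (s1 s2 : seq (nat * nat)) (c : 'I_W -> 'I_W -> R)
    (u1 u2 : 'I_W -> tensor R D) x :
  [disjoint K1 & K2] ->
  (forall r, depends_on K1 (u1 r)) -> (forall r, depends_on K2 (u2 r)) ->
  (forall t, t \in s1 -> block t \subset K1) -> (forall t, t \in s2 -> block t \subset K2) ->
  projs block F s1 (projs block F s2 (fun x => \sum_i \sum_j c i j * u1 i x * u2 j x)) x =
  \sum_i \sum_j c i j * projs block F s1 (u1 i) x * projs block F s2 (u2 j) x.
Proof.
move=> KK u1K u2K s1K s2K.
have s2u1 t : t \in s2 -> [disjoint block t & K1].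
  by move=> /s2K h; rewrite disjoint_sym; apply: disjointWr h KK.
have s1u2 t : t \in s1 -> [disjoint block t & K2].
  by move=> /s1K h; apply: disjointWl h KK.
transitivity (projs block F s1 (projs block F s2
    (fun x => \sum_(p : 'I_W * 'I_W) c p.1 p.2 * (u1 p.1 x * u2 p.2 x))) x).
  do 2![apply: eq_projs => {}x]; rewrite pair_bigA /=.
  by apply: eq_bigr => p _; rewrite mulrA.
rewrite (eq_projs _ _ _ (projs_sum _ _ _ _ _)) projs_sum pair_bigA /=.
apply: eq_bigr => -[i j] _ /=; rewrite -mulrA; congr (_ * _).
rewrite mulrC -(projs_mull _ _ _ (depends_on_projs s2K FK (u2K j)) s1u2).
by apply: eq_projs => {}x; rewrite (projs_mull _ _ _ (u1K i) s2u1) mulrC.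
Qed.

(** These are the brackets of [proj2E] for [F (l, n) r]. [node] reads them at successor levels,
    where [l.-1] is the level of the children. *)
Definition coefficient l n (r i j : 'I_W) : R :=
  \sum_z \sum_y F (l.-1, n.*2) i z * F (l.-1, n.*2.+1) j y *
    F (l, n) r (mix (block (l.-1, n.*2.+1)) y z).

Variable v : forall n : 'I_N, 'I_W -> 'I_(D n) -> R.
Hypothesis vE : forall n r x, (n < N)%N -> leafval v n r x = F (0, n) r x.

(** Induction from the leaves: [projs_product] pulls the projections below the children out of the
    sum, and [proj2E] recognizes what remains as [F (l, n) r] projected at both children. The bound
    keeps all leaves below the node in range. *)
Lemma node_projs l n r x : (2 ^ l * n.+1 <= N)%N ->
  node v coefficient l n r x = projs block F (descendants l n) (F (l, n) r) x.
Proof.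
elim: l n r x => [|l IH] n r x /=; first by rewrite mul1n; exact: vE.
rewrite expnS => nN; rewrite !projs_cat /=.
have nN2 : (2 ^ l * n.*2.+2 <= N)%N by move: nN; rewrite -muln2; lia.
have nN1 : (2 ^ l * n.*2.+1 <= N)%N by apply: leq_trans nN2; rewrite leq_mul2l leqnSn orbT.
under eq_bigr => i _ do under eq_bigr => j _ do rewrite !IH //.
rewrite -(@projs_product (block (l, n.*2)) (block (l, n.*2.+1))) ?block_disjoint //;
  try exact: descendants_block.
do 2![apply: eq_projs => {}x].
rewrite (@proj2E _ _ _ _ _ _ (F (l, n.*2)) (F (l, n.*2.+1))) ?block_disjoint //.
by rewrite -block_split.
Qed.

End Tree.

Section Leaves.
Variables (R : realType) (N : nat) (D : 'I_N -> nat) (W : nat).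

Lemma leaf_vectors (f : nat -> 'I_W -> tensor R D) :
  (forall (n : 'I_N) r, depends_on [set n] (f n r)) ->
  exists v : forall n : 'I_N, 'I_W -> 'I_(D n) -> R,
    forall n r x, (n < N)%N -> leafval v n r x = f n r x.
Proof.
move=> fK.
(* Every multi-index with [n]-th coordinate [d] gives the same value; the default [0] occurs only if
   there is none. *)
exists (fun n r d => if [pick x : Idx D | x n == d] is Some x then f n r x else 0).
move=> n r x nN; rewrite /leafval insubT /=.
case: pickP => [y /eqP yx|/(_ x)]; last by rewrite eqxx.
by apply: (fK (Ordinal nN)) => m /set1P ->.
Qed.

End Leaves.

(** * Assembly of the network and total error *)

Theorem theorem2 (R : realType) (L : nat) (D : 'I_(2 ^ L) -> nat) (W : nat)
    (A : tensor R D) (eps : R) :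
  (0 < L)%N -> (forall n, (0 < D n)%N) -> (0 < W)%N -> 0 < eps ->
  (forall K : {set 'I_(2 ^ L)}, canonical_partition L K ->
     QE_le A K (eps ^+ 2 / ((2 * 2 ^ L - 3)%N%:R * tnorm A ^+ 2) * ln (W%:R : R))) ->
  exists (v : forall n : 'I_(2 ^ L), 'I_W -> 'I_(D n) -> R)
         (a : nat -> nat -> 'I_W -> 'I_W -> 'I_W -> R)
         (atop : 'I_W -> 'I_W -> R),
    tnorm (fun x => tn_tensor L v a atop x - A x) <= eps.
Proof.
(* From here on the tree has height [L.+1], and [L] is the level of the two children of the root. *)
case: L D A => // L D A _ D0 W0 eps0 QE.
pose d : R := eps ^+ 2 / (2 * 2 ^ L.+1 - 3)%N%:R.
have size0 : (0 < 2 * 2 ^ L.+1 - 3)%N by rewrite expnS; have := expn_gt0 2 L; lia.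
have d0 : 0 <= d by rewrite divr_ge0 ?sqr_ge0 ?ler0n.
have AA : tnorm A ^+ 2 = tdot A A.
  rewrite /tnorm sqr_sqrtr; last by apply: sumr_ge0 => x _; rewrite sqr_ge0.
  by apply: eq_bigr => x _; rewrite expr2.
have cut t : exists u : 'I_W -> tensor R D,
    (forall r, depends_on (block _ t) (u r)) /\
    ((t.1 <= L)%N -> (t.2 < 2 ^ (L.+1 - t.1))%N -> frame (block _ t) u /\
     tdot (fun x => A x - proj (block _ t) u A x) (fun x => A x - proj (block _ t) u A x) <= d).
  case: (boolP ((t.1 <= L)%N && (t.2 < 2 ^ (L.+1 - t.1))%N)) => [/andP[tL tn]|tN]; last first.
    (* Outside the tree the zero family will do, so that choice gives a function [G] on all
       pairs. *)
    exists (fun _ _ => 0); split => // h1 h2; by rewrite h1 h2 in tN.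
  have cK : canonical_partition L.+1 (block (2 ^ L.+1) t).
    (* [canonical_partition] counts levels from the root, [block] from the leaves. *)
    exists (L.+1 - t.1)%N, t.2; rewrite leq_subr tn; split => //; split => //.
    by rewrite subKn // leqW.
  have [u [fr Eu]] := frame_of_entropy W D0 (QE _ cK).
  exists u; split; [by case: fr | split => //].
  (* [ln (W + 1)] instead of [ln W], which vanishes for [W = 1]. *)
  have lnW : 0 < ln (W.+1%:R : R) by rewrite ln_gt0 // ltr1n ltnS.
  rewrite -(ler_pM2r lnW); apply: le_trans Eu _.
  have lnWW : ln (W%:R : R) <= ln W.+1%:R.
    by rewrite ler_ln ?posrE ?ltr0n // ler_nat.
  apply: le_trans (ler_wpM2l d0 lnWW).
  rewrite mulrA ler_wpM2r ?ln_ge0 ?ler1n // AA /d.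
  (* For [A = 0] the left side is [0]; otherwise the squared norm cancels. *)
  have [->|A0] := eqVneq (tdot A A) 0; first by rewrite mul0r divr_ge0 ?sqr_ge0 ?ler0n.
  by rewrite invfM mulrA [tdot A A * _]mulrC mulrACA mulfV ?mulr1.
have [G GP] := choice cut.
have GK t r : depends_on (block _ t) (G t r) by case: (GP t).
pose c r : tensor R D := fun x => \sum_y G (L, 0%N) r y * A (mix (block _ (L, 0%N)) y x).
have full : block (2 ^ L.+1) (L, 0%N) :|: block (2 ^ L.+1) (L, 1%N) = setT.
  rewrite -(block_split _ L 0); apply/setP => i.
  by rewrite !inE /= muln0 muln1 ltn_ord.
have cK r : depends_on (block _ (L, 1%N)) (c r).
  move=> x y xy; apply: eq_bigr => z _; congr (_ * A _); apply/ffunP => n; rewrite !mixE.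
  case: ifP => // nN; apply: xy; have := in_setT n; rewrite -full inE nN; exact.
(* No projection is made at the right child of the root: its vectors are the
   cofactors in the projection at the left child. *)
pose F t := if t == (L, 1%N) then c else G t.
have FK t r : depends_on (block _ t) (F t r).
  by rewrite /F; case: eqP => [->|_]; [exact: cK | exact: GK].
have FG t : t != (L, 1%N) -> F t = G t by rewrite /F => /negbTE ->.
have L01 : (L, 0%N) != (L, 1%N) by rewrite xpair_eqE andbF.
have [v vE] : exists v : forall n : 'I_(2 ^ L.+1), 'I_W -> 'I_(D n) -> R,
    forall n r x, (n < 2 ^ L.+1)%N -> leafval v n r x = F (0%N, n) r x.
  apply: leaf_vectors => n r; apply: depends_on_sub (FK _ r).
  by apply/subsetP => i; rewrite !inE /= !mul1n ltnS => h; apply/eqP/val_inj/eqP;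
    rewrite eqn_leq andbC.
(* The top matrix is the identity: the projection of [A] at [(L, 0)] pairs the [r]-th vector there
   with its cofactor [c r]. *)
exists v, (coefficient F), (fun i j => (i == j)%:R).
(* Placed last, [(L, 0)] acts first on [A]. With [N = 2 ^ L.+1], each half contributes [N - 2]
   descendants, hence [2N - 3] projections in all. *)
pose s := descendants L 0 ++ descendants L 1 ++ [:: (L, 0%N)].
have sE : size s = (2 * 2 ^ L.+1 - 3)%N.
  rewrite !size_cat !size_descendants /=; have := expn_gt0 2 L; rewrite !expnS; lia.
have TNE x : tn_tensor L.+1 v (coefficient F) (fun i j => (i == j)%:R) x = projs (block _) F s
  A x.
  rewrite /tn_tensor /= /s !projs_cat /=.
  under eq_bigr => i _ do under eq_bigr => j _ do
    rewrite !(node_projs FK vE) ?muln1 ?leq_exp2l ?expnS 1?mulnC //.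
  rewrite -(@projs_product _ _ _ _ F FK (block _ (L, 0%N)) (block _ (L, 1%N))) //; last first.
  - exact: descendants_block.
  - exact: descendants_block.
  - exact: (block_disjoint _ L 0).
  do 2![apply: eq_projs => {}x]; apply: eq_bigr => i _.
  rewrite (bigD1 i) //= eqxx mul1r big1 ?addr0 => [|j ji]; last first.
    by rewrite eq_sym (negbTE ji) !mul0r.
  by rewrite {2}/F eqxx /c FG.
have : tdot (fun x => A x - projs (block _) F s A x) (fun x => A x - projs (block _) F s A x)
    <= (size s)%:R * d.
  apply: projs_error => t; rewrite !mem_cat inE => ts.
  (* Every node of [s] lies in the tree and differs from [(L, 1)], so [F] agrees with [G] there and
     the bound of [cut] applies. *)
  have [tL [tn tN]] : (t.1 <= L)%N /\ (t.2 < 2 ^ (L.+1 - t.1))%N /\ t != (L, 1%N).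
    have desc n : (n < 2 ^ 1)%N -> t \in descendants L n ->
        (t.1 <= L)%N /\ (t.2 < 2 ^ (L.+1 - t.1))%N /\ t != (L, 1%N).
      move=> n2 /descendants_range/(_ n2); rewrite addn1 => -[h1 h2].
      split; [exact: ltnW | split => //]; apply: contraTneq h1 => ->.
      by rewrite ltnn.
    case/orP: ts => [/desc|/orP[/desc|/eqP ->]]; [exact | exact |].
    by rewrite L01 /= leqnn expn_gt0.
  by rewrite FG //; case: (GP t) => _; exact.
rewrite sE /d mulrC divfK ?pnatr_eq0 -?lt0n // => E.
rewrite /tnorm -[leRHS](ger0_norm (ltW eps0)) -sqrtr_sqr ler_wsqrtr //.
apply: le_trans E; rewrite le_eqVlt; apply/orP; left; apply/eqP; apply: eq_bigr => x _.
by rewrite TNE -expr2 -sqrrN opprB.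
Qed.
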